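(* Let $T=\{1324, 2143, 2341\}$. Then $$F_T(x)=\frac{1-6x+12x^2-8x^3+3x^4-x^5}{(1-x)(1-3x+x^2)^2}.$$
   Context: $S_n(T)$ denotes the set of permutations $\pi$ of $[n]=\{1,\dots,n\}$ (one-line notation) that avoid every pattern $\tau\in T$, i.e. no subsequence of $\pi$ is order-isomorphic to $\tau$. $F_T(x)=\sum_{n\ge 0}|S_n(T)|x^n$, a formal power series, with $|S_0(T)|=1$. *)

(* Defs.v *)
From HB Require Import structures.
From mathcomp Require Import all_boot all_order all_fingroup all_algebra.

Set Implicit Arguments.
Unset Strict Implicit.
Unset Printing Implicit Defensive.

Import GRing.Theory.

Definition order_iso (u v : seq nat) : bool :=
  (size u == size v) &&
  [forall i : 'I_(size u), forall j : 'I_(size u),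
    (nth 0 u i < nth 0 u j) == (nth 0 v i < nth 0 v j)].

                                                                         
                                                            
Definition contains (s tau : seq nat) : bool :=
  [exists m : (size s).-tuple bool, order_iso (mask m s) tau].

Definition avoids (s tau : seq nat) : bool := ~~ contains s tau.

Lemma containsP (s tau : seq nat) :
  reflect (exists2 u, subseq u s & order_iso u tau) (contains s tau).
Proof.
apply: (iffP existsP) => [[m iso_m]|[u /subseqP[m sz_m ->] iso_m]].
  by exists (mask m s); rewrite ?mask_subseq.
have sz_m' : size m == size s by apply/eqP.
by exists (Tuple sz_m').
Qed.

                                                                       
Definition oneline (n : nat) (pi : 'S_n) : seq nat :=
  [seq (val (pi i)).+1 | i <- enum 'I_n].

Definition avoiders (n : nat) (T : seq (seq nat)) : {set 'S_n} :=
  [set pi : 'S_n | all (avoids (oneline pi)) T].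

Lemma card_avoiders0 (T : seq (seq nat)) :
  [::] \notin T -> #|avoiders 0 T| = 1.
Proof.
move=> T0; suff -> : avoiders 0 T = setT by rewrite cardsT card_Sn.
apply/setP=> pi; rewrite !inE; apply/allP=> tau tauT.
apply/containsP=> -[u]; have -> : oneline pi = [::].
  by apply: size0nil; rewrite size_map size_enum_ord.
rewrite subseq0 => /eqP-> /andP[/eqP/esym/size0nil tau0 _].
by rewrite -tau0 tauT in T0.
Qed.

Local Open Scope ring_scope.

                                                                       
                                         
Definition fps (R : Type) : Type := nat -> R.

Definition fps_of_poly (R : nzRingType) (p : {poly R}) : fps R := fun n => p`_n.

Definition fps_mul (R : nzRingType) (f g : fps R) : fps R :=
  fun n => \sum_(i < n.+1) f i * g (n - i)%N.

                                                                            
Fixpoint fps_inv_rec (R : unitRingType) (f : fps R) (n : nat) : seq R :=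
  if n is m.+1 then
    let s := fps_inv_rec f m in
    - (f 0%N)^-1 * (\sum_(i < m.+1) f i.+1 * s`_i) :: s
  else [:: (f 0%N)^-1].

                                                  
Definition fps_inv (R : unitRingType) (f : fps R) : fps R :=
  fun n => (fps_inv_rec f n)`_0.

Definition fps_div (R : unitRingType) (f g : fps R) : fps R :=
  fps_mul f (fps_inv g).

Lemma fps_inv_recE (R : unitRingType) (f : fps R) (n i : nat) :
  (i <= n)%N -> (fps_inv_rec f n)`_i = fps_inv f (n - i)%N.
Proof.
elim: n i => [|n IHn] [|i] //= le_in.
by rewrite subSS IHn.
Qed.

Lemma fps_mulV (R : unitRingType) (f : fps R) :
  f 0%N \is a GRing.unit -> fps_mul f (fps_inv f) =1 fps_of_poly 1.
Proof.
move=> f0U [|n]; rewrite /fps_mul /fps_of_poly coef1 big_ord_recl.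
  by rewrite big_ord0 addr0 [fps_inv f _]/(f 0%N)^-1 divrr.
rewrite subn0 {1}/fps_inv /= mulNr mulrN mulVKr // addrC.
apply/eqP; rewrite subr_eq0; apply/eqP/eq_bigr => i _.
by rewrite fps_inv_recE ?subSS // -ltnS ltn_ord.
Qed.

Definition gen_fun (T : seq (seq nat)) : fps int :=
  fun n => #|avoiders n T|%:Z.

(* Main.v *)
Require Import Defs.
From mathcomp Require Import all_boot all_order all_fingroup all_algebra.
From mathcomp Require Import zify ring.

(** Permutations are generated by prepending a new first letter [a] and raising
    the letters [>= a] by one. The values [a] for which the result still avoids
    the three patterns (the active sites) obey a generating tree with four
    families of labels:
      [I h] (the increasing permutation of length [h+1]), with children
        [I (h+1)], [C 0], ..., [C (h-1)], [G h 1];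
      [C l], with children [C l], [C 0], ..., [C l], [B (l+4)];
      [B k], with children [k-1] times [B 2], then [B (k+1)];
      [G j i], with children [i+1] times [G 1 0], [j] times [B 2], [G j (i+1)].
    The number of descendants at a given depth is affine in the parameters for
    [B] and [G]; for [I] it is a sum along an antidiagonal of descendant numbers
    for [C] and [G], and such sums satisfy linear recurrences. *)

Set Implicit Arguments.
Unset Strict Implicit.
Unset Printing Implicit Defensive.

(** * Avoidance and active sites *)

(* The disjuncts correspond to 1324, 2143 and 2341. *)
Definition bad (a x y z : nat) : bool :=
  [|| [&& a < y, y < x & x < z], [&& x < a, a < z & z < y]
    | [&& z < a, a < x & x < y]].

(* [bad] for a new first letter [b], with [x], [y], [z] the letters before
   they are raised. *)
Definition kill (b x y z : nat) : bool :=
  [|| [&& b <= y, y < x & x < z], [&& x < b, b <= z & z < y]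
    | [&& z < b, b <= x & x < y]].

(* [kill] for the site [b] of [ins a p], when [x] is the first letter [a] and
   [y], [z] are letters of [p]. *)
Definition pkill (a b y z : nat) : bool :=
  [|| [&& b <= y, y < a & a <= z], [&& a < b, b <= z.+1 & z < y]
    | [&& z < b, b <= a & a <= y]].

Definition ins (a : nat) (p : seq nat) : seq nat := a :: map (bump a) p.

Definition avoid (p : seq nat) : Prop :=
  forall a x y z, subseq [:: a; x; y; z] p -> ~~ bad a x y z.

Definition site (p : seq nat) (b : nat) : Prop :=
  forall x y z, subseq [:: x; y; z] p -> ~~ kill b x y z.

Definition avT (p : seq nat) : bool :=
  all (avoids p) [:: [:: 1; 3; 2; 4]; [:: 2; 1; 4; 3]; [:: 2; 3; 4; 1]].

Lemma order_iso4 (u : seq nat) (t : 4.-tuple nat) :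
  order_iso u t -> exists a x y z, u = [:: a; x; y; z].
Proof.
case/andP=> /eqP; rewrite size_tuple.
by case: u => [|a [|x [|y [|z []]]]] // _ _; exists a, x, y, z.
Qed.

Lemma forall_I4 (P : nat -> nat -> bool) :
  [forall i : 'I_4, forall j : 'I_4, P i j] =
  all (fun i => all (P i) (iota 0 4)) (iota 0 4).
Proof.
apply/forallP/allP=> [h i|h i].
  rewrite mem_iota => lti; apply/allP=> j; rewrite mem_iota => ltj.
  by have /forallP/(_ (Ordinal ltj)) := h (Ordinal lti).
have mem_I4 (k : 'I_4) : val k \in iota 0 4 by rewrite mem_iota ltn_ord.
by apply/forallP=> j; have /allP/(_ _ (mem_I4 j)) := h _ (mem_I4 i).
Qed.

Lemma avoidP (p : seq nat) : reflect (avoid p) (avT p).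
Proof.
have isoE a x y z t : size t = 4 -> order_iso [:: a; x; y; z] t =
  all (fun i => all (fun j =>
      (nth 0 [:: a; x; y; z] i < nth 0 [:: a; x; y; z] j)
      == (nth 0 t i < nth 0 t j)) (iota 0 4)) (iota 0 4).
  move=> st; rewrite /order_iso st andTb.
  exact: (forall_I4 (fun i j => (nth 0 [:: a; x; y; z] i < _) == _)).
apply: (iffP allP) => [h a x y z sub|h t].
  apply/negP=> /or3P[] bd.
  - have := h [:: 1; 3; 2; 4] isT; apply/negP/negPn/containsP.
    by exists [:: a; x; y; z] => //; rewrite isoE //=; lia.
  - have := h [:: 2; 1; 4; 3] isT; apply/negP/negPn/containsP.
    by exists [:: a; x; y; z] => //; rewrite isoE //=; lia.
  - have := h [:: 2; 3; 4; 1] isT; apply/negP/negPn/containsP.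
    by exists [:: a; x; y; z] => //; rewrite isoE //=; lia.
rewrite !inE => /or3P[] /eqP-> ; apply/containsP => -[u sub iso];
  have [a [x [y [z ue]]]] := order_iso4 (t := [tuple of [:: _; _; _; _]]) iso;
  move: iso; rewrite ue isoE //=; rewrite ue in sub;
  have := h _ _ _ _ sub; rewrite /bad; lia.
Qed.

Lemma size_ins (a : nat) (p : seq nat) : size (ins a p) = (size p).+1.
Proof. by rewrite /= size_map. Qed.

Lemma subseq_mapP (f : nat -> nat) (p u : seq nat) :
  subseq u (map f p) -> exists2 w, subseq w p & u = map f w.
Proof.
case/subseqP=> m _ ->; exists (mask m p); first exact: mask_subseq.
by rewrite map_mask.
Qed.

Lemma subseq_ins (a b : nat) (u p : seq nat) :
  subseq (b :: u) (ins a p) ->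
  (b = a /\ exists2 w, subseq w p & u = map (bump a) w)
  \/ exists2 w, subseq w p & b :: u = map (bump a) w.
Proof.
rewrite /ins /=; case: eqP => [-> | _] /subseq_mapP; by [left | right].
Qed.

Lemma map3P (f : nat -> nat) x y z w : [:: x; y; z] = map f w ->
  exists x' y' z', w = [:: x'; y'; z'] /\ [/\ x = f x', y = f y' & z = f z'].
Proof.
by case: w => [|x' [|y' [|z' []]]] // [-> -> ->]; exists x', y', z'.
Qed.

Lemma subseq_map_cons (f : nat -> nat) u p a :
  subseq u p -> subseq (map f u) (a :: map f p).
Proof. by move=> /(map_subseq f)/subseq_trans; apply; apply: subseq_cons. Qed.

Lemma subseq_cons_map (f : nat -> nat) u p a :
  subseq u p -> subseq (a :: map f u) (a :: map f p).
Proof. by move=> /(map_subseq f); rewrite /= eqxx. Qed.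

(** An occurrence in [ins b p] either lies in the raised copy of [p], where [bump b] keeps the
    order, or starts with [b]; in that case its other three letters kill the site [b]. *)
Lemma avoid_ins (b : nat) (p : seq nat) :
  avoid (ins b p) <-> avoid p /\ site p b.
Proof.
split=> [h | [hp hb] a x y z].
  split=> [a x y z | x y z] sub.
  - have := h _ _ _ _ (subseq_map_cons (bump b) b sub).
    rewrite /bad /bump; lia.
  - have := h _ _ _ _ (subseq_cons_map (bump b) b sub).
    rewrite /bad /kill /bump; lia.
case/subseq_ins=> [[->]|] [w sub].
  case/map3P=> x' [y'] [z'] [we] [-> -> ->]; rewrite we in sub.
  have := hb _ _ _ sub; rewrite /bad /kill /bump; lia.
case: w sub => [|a' w] // sub [-> /map3P [x'] [y'] [z'] [we] [-> -> ->]].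
rewrite we in sub; have := hp _ _ _ _ sub; rewrite /bad /bump; lia.
Qed.

Definition prec (p : seq nat) (y z : nat) : Prop := subseq [:: y; z] p.

(** A triple of [ins a p] either starts with [a], leaving a pair of [p] for [pkill], or lies in the
    raised copy of [p], where [b <= bump a x] amounts to [unbump a b <= x]. *)
Lemma site_ins (a b : nat) (p : seq nat) :
  site (ins a p) b <->
  site p (unbump a b) /\ forall y z, prec p y z -> ~~ pkill a b y z.
Proof.
split=> [h | [hb hp] x y z].
  split=> [x y z | y z] sub.
  - have := h _ _ _ (subseq_map_cons (bump a) a sub).
    rewrite /kill /bump /unbump; lia.
  - have := h _ _ _ (subseq_cons_map (bump a) a sub).
    rewrite /pkill /kill /bump; lia.
case/subseq_ins=> [[->]|] [w sub].
  case: w sub => [|y' [|z' []]] // sub [-> ->].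
  have := hp _ _ sub; rewrite /pkill /kill /bump; lia.
case/map3P=> x' [y'] [z'] [we] [-> -> ->]; rewrite we in sub.
have := hb _ _ _ sub; rewrite /kill /bump /unbump; lia.
Qed.

Definition good (p : seq nat) : Prop :=
  perm_eq p (iota 1 (size p)) /\ avoid p.

Definition sites (p : seq nat) (S : pred nat) : Prop :=
  forall b, 1 <= b <= (size p).+1 -> (site p b <-> S b).

Lemma good_mem p x : good p -> (x \in p) = (1 <= x <= size p).
Proof. by case=> /perm_mem pE _; rewrite pE mem_iota add1n ltnS. Qed.

Lemma good_uniq p : good p -> uniq p.
Proof. by by case=> /perm_uniq E _; rewrite E iota_uniq. Qed.

Lemma perm_ins a p : 1 <= a <= (size p).+1 -> perm_eq p (iota 1 (size p)) ->
  perm_eq (ins a p) (iota 1 (size p).+1).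
Proof.
move=> le_a hp; apply: uniq_perm; last 1 first.
- move=> x; rewrite inE mem_iota; apply/orP/idP=> [[/eqP->|/mapP[y]]|].
  + lia.
  + rewrite (perm_mem hp) mem_iota => hy ->; rewrite /bump; lia.
  move=> hx; case: (eqVneq x a) => [|xa]; [by left | right].
  apply/mapP; exists (unbump a x); last by rewrite unbumpK ?inE.
  rewrite (perm_mem hp) mem_iota /unbump; lia.
- rewrite /= (map_inj_uniq (can_inj (bumpK a))) (perm_uniq hp) iota_uniq andbT.
  by apply/mapP=> -[y _]; rewrite /bump; lia.
exact: iota_uniq.
Qed.

Lemma good_ins a p : good p -> 1 <= a <= (size p).+1 -> site p a ->
  good (ins a p).
Proof.
case=> hp av le_a ha; split; last by apply/avoid_ins.
by rewrite size_ins; apply: perm_ins.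
Qed.

Lemma prec_bound p y z : good p -> prec p y z ->
  [&& 0 < y, y <= size p, 0 < z & z <= size p].
Proof.
move=> gp /mem_subseq sub; have := sub y; have := sub z.
rewrite !inE !eqxx orbT !good_mem // => /(_ isT) /andP[-> ->].
by move=> /(_ isT)/andP[-> ->].
Qed.

Lemma prec_asym p y z : good p -> prec p y z -> prec p z y -> False.
Proof.
move=> /good_uniq; rewrite /prec; elim: p => //= x p IHp /andP[xp up].
have memN u : subseq [:: u; x] p -> x \in p.
  by move/mem_subseq; apply; rewrite !inE eqxx orbT.
have [?|yx] := eqVneq y x; have [?|zx] := eqVneq z x; subst; last exact: IHp.
- by rewrite sub1seq (negPf xp).
- by move=> _ /memN; rewrite (negPf xp).
- by move=> /memN; rewrite (negPf xp).
Qed.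

Lemma prec_neq p y z : good p -> prec p y z -> y != z.
Proof.
move=> gp h; apply/eqP=> yz; rewrite yz in h.
by apply: (prec_asym gp h h).
Qed.

Lemma prec_ins a p y z : prec p y z -> prec (ins a p) (bump a y) (bump a z).
Proof. exact: subseq_map_cons. Qed.

Lemma prec_ins_head a p z : z \in p -> prec (ins a p) a (bump a z).
Proof. by move=> zp; apply: (@subseq_cons_map _ [:: z]); rewrite sub1seq. Qed.

(** * Labels of the generating tree *)

(** Common frame of the generating rules: each predicted site comes from a site of the parent and
    survives the new first letter, while every other inherited site is killed by an exhibited
    pair. *)
Lemma step_ins (S S' : pred nat) a p :
  good p -> sites p S -> 1 <= a <= (size p).+1 -> S a ->
  (forall b, 1 <= b <= (size p).+2 -> S' b -> S (unbump a b)) ->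
  (forall b y z, 1 <= b <= (size p).+2 -> S' b -> prec p y z ->
     [&& 0 < y, y <= size p, 0 < z & z <= size p] -> ~~ pkill a b y z) ->
  (forall b, 1 <= b <= (size p).+2 -> ~~ S' b -> S (unbump a b) ->
     exists y z, prec p y z /\ pkill a b y z) ->
  good (ins a p) /\ sites (ins a p) S'.
Proof.
move=> gp hS le_a Sa h1 h2 h3; split; first by apply: good_ins; rewrite ?hS.
move=> b; rewrite size_ins => le_b; rewrite site_ins.
have le_ub : 1 <= unbump a b <= (size p).+1 by rewrite /unbump; lia.
rewrite hS //; split=> [[Sb hk]|Sb]; last first.
  by split=> [|y z yz]; [exact: h1 | apply: h2 => //; exact: prec_bound].
apply/negPn/negP=> /h3 [] // y [z [/hk/negP hn]]; exact: hn.
Qed.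

(** The sites are the [k] largest values. The last two fields keep at hand the pairs that kill sites
    in the children: the maximum followed by a letter below all sites, and by its predecessor. *)
Definition typeB (k : nat) (p : seq nat) : Prop :=
  [/\ good p, 1 < k <= size p, sites p (fun b => (size p).+2 <= b + k),
      exists2 z, prec p (size p) z & z + k <= (size p).+1
    & 2 < k -> prec p (size p) (size p).-1].

(** There are [l + 3] sites, from [m] on. The fourth field makes [p] end with [m+1, ..., size p] in
    increasing order; the last one provides the pair that kills the site [m] once [m] is
    inserted. *)
Definition typeC (m l : nat) (p : seq nat) : Prop :=
  [/\ good p, size p = m + l.+1, sites p (fun b => m <= b),
      forall y z, m < y <= size p -> 1 <= z < y -> prec p z y
    & exists2 z, prec p m z & z < m].

(* Plays the role of [typeG] with [j = 1] and [i = 0]. *)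
Definition typeX (p : seq nat) : Prop :=
  [/\ good p, sites p (fun b => (b == 1) || (size p <= b)),
      exists y, prec p y (size p) & exists z, prec p (size p) z].

(** The word starts with [size p, ..., m+1] in decreasing order. The last field gives, for each of
    the [j] sites [c] ending at [m], an increasing pair across [c]; it kills low sites after [c] is
    inserted. *)
Definition typeG (m j i : nat) (p : seq nat) : Prop :=
  [/\ good p, [/\ size p = m + i, j < m & 0 < i],
      sites p (fun b => (b == 1) || (m < b + j)),
      forall y z, m < y <= size p -> 1 <= z < y -> prec p y z
    & forall c, m < c + j -> c <= m -> exists y z, prec p y z /\ y < c <= z].

Lemma prec_insE a p y z y' z' :
  prec p y z -> y' = bump a y -> z' = bump a z -> prec (ins a p) y' z'.
Proof. by move=> yz -> ->; apply: prec_ins. Qed.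

Lemma prec_ins_headE a p z z' :
  good p -> 1 <= z <= size p -> z' = bump a z -> prec (ins a p) a z'.
Proof. by move=> gp lez ->; apply: prec_ins_head; rewrite good_mem. Qed.

Lemma tail_ins m m' a p :
  good p -> (forall y z, m < y <= size p -> 1 <= z < y -> prec p z y) ->
  0 < a <= m' -> m < m' -> forall y z, m' < y <= size (ins a p) -> 1 <= z < y ->
  prec (ins a p) z y.
Proof.
move=> gp tl am mm y z; rewrite size_ins => hy hz.
have [->|za] := eqVneq z a.
  by apply: (prec_ins_headE (z := y.-1)) => //; rewrite /bump; lia.
apply: (prec_insE (y := unbump a z) (z := unbump a y)).
- by apply: tl; rewrite /unbump; lia.
- by rewrite unbumpK.
- by rewrite unbumpK // inE; lia.
Qed.

(** * Children of each label *)

Lemma typeB_low k p a : typeB k p -> (size p).+2 <= a + k -> a <= size p ->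
  typeB 2 (ins a p).
Proof.
case=> gp lek hS [z nz lez] nn le_a a_le; have zb := prec_bound gp nz.
have [gi si] : good (ins a p) /\ sites (ins a p) (fun b => size p < b).
  apply: (step_ins gp hS) => // [|b|b y z'|b hb nb ub].
  - lia.
  - rewrite /unbump; lia.
  - rewrite /pkill; lia.
  (* At or below [a], the site completes 2341 with [a], the maximum and the low letter [z]. Above
     [a], it completes 2143 with [a] and the two largest letters; there [a < size p], which forces
     [k > 2]. *)
  case: (leqP b a) => ba.
    exists (size p), z; split=> //; move: ub; rewrite /pkill /unbump; lia.
  exists (size p), (size p).-1; split; last by rewrite /pkill; lia.
  apply: nn; lia.
split=> //; try (rewrite size_ins; lia).
- by move=> b; rewrite size_ins => hb; rewrite si ?size_ins //; lia.
exists z; last by rewrite size_ins; lia.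
by apply: (prec_insE nz); rewrite ?size_ins /bump; lia.
Qed.

(** In each of the three patterns the second letter is below some later letter, so a maximum placed
    first can never serve as that second letter: no site is lost and the top site splits in two. *)
Lemma top_ins p (S S' : pred nat) : good p -> sites p S -> S (size p).+1 ->
  (forall b, 1 <= b <= (size p).+1 -> S' b = S b) -> S' (size p).+2 ->
  good (ins (size p).+1 p) /\ sites (ins (size p).+1 p) S'.
Proof.
move=> gp hS Sn S1 S2; apply: (step_ins gp hS) => // [|b hb|b y z|b hb nb].
- lia.
- have [->|bn] := eqVneq b (size p).+2.
    by rewrite /unbump ltnSn subn1.
  have -> : unbump (size p).+1 b = b by rewrite /unbump; lia.
  by rewrite S1 //; lia.
- rewrite /pkill; lia.
have [E|bn] := eqVneq b (size p).+2; first by rewrite E S2 in nb.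
have -> : unbump (size p).+1 b = b by rewrite /unbump; lia.
by rewrite S1 in nb; [rewrite (negPf nb) | lia].
Qed.

Lemma typeB_top k p : typeB k p -> typeB k.+1 (ins (size p).+1 p).
Proof.
case=> gp lek hS [z nz lez] nn; have zb := prec_bound gp nz.
have [|||gi si] := top_ins (S' := fun b => (size p).+2 <= b + k) gp hS; try lia.
split=> //; try (rewrite size_ins; lia).
- by move=> b; rewrite size_ins => hb; rewrite si ?size_ins //; lia.
- exists z; last by rewrite size_ins; lia.
  by rewrite size_ins; apply: (prec_ins_headE (z := z)); rewrite ?/bump //; lia.
- move=> _; rewrite size_ins.
  by apply: (prec_ins_headE (z := size p)); rewrite ?/bump //; lia.
Qed.

Lemma typeC_bottom m l p : typeC m l p -> typeC m.+1 l (ins m p).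
Proof.
case=> gp sp hS tl [z mz ltz]; have zb := prec_bound gp mz.
have [gi si] : good (ins m p) /\ sites (ins m p) (fun b => m < b).
  apply: (step_ins gp hS) => // [|b|b y z' hb Sb yz zb'|b hb nb ub].
  - lia.
  - rewrite /unbump; lia.
  (* Only 2143 could kill such a site, through a descent starting above [m], which the increasing
     tail rules out. *)
  - apply/negP=> K; case: (prec_asym gp yz); apply: tl.
      move: K; rewrite /pkill; lia.
    move: K; rewrite /pkill; lia.
  exists m, z; split=> //; move: ub; rewrite /pkill /unbump; lia.
split=> //; first by rewrite size_ins; lia.
- apply: tail_ins tl _ _ => //; lia.
- by exists z; [apply: (prec_insE mz) | ]; rewrite /bump; lia.
Qed.

(** Every site below [a] completes 1324 with the new [a] and the old letters [a - 1], [a]. Assuming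
    less than [typeC] lets the rule also serve the increasing permutation, with [m = 1]. *)
Lemma typeC_mid m p a : good p -> 0 < m -> sites p (fun b => m <= b) ->
  (forall y z, m < y <= size p -> 1 <= z < y -> prec p z y) ->
  m < a <= size p -> typeC a (size p - a) (ins a p).
Proof.
move=> gp m_gt0 hS tl le_a.
have [gi si] : good (ins a p) /\ sites (ins a p) (fun b => a <= b).
  apply: (step_ins gp hS) => // [||b|b y z' hb Sb yz zb'|b hb nb ub].
  - lia.
  - lia.
  - rewrite /unbump; lia.
  - apply/negP=> K; case: (prec_asym gp yz); apply: tl.
      move: K; rewrite /pkill; lia.
    move: K; rewrite /pkill; lia.
  exists a.-1, a; split; first by apply: tl; lia.
  move: ub; rewrite /pkill /unbump; lia.
split=> //; first by rewrite size_ins; lia.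
- apply: tail_ins tl _ _ => //; lia.
exists 1; last by lia.
by apply: (prec_ins_headE (z := 1)); rewrite // /bump; lia.
Qed.

Lemma typeC_top m l p : typeC m l p -> typeB l.+4 (ins (size p).+1 p).
Proof.
case=> gp sp hS tl [z mz ltz]; have zb := prec_bound gp mz.
have [|||gi si] := top_ins (S' := fun b => m <= b) gp hS; try lia.
have top x : 1 <= x <= size p -> prec (ins (size p).+1 p) (size p).+1 x.
  by move=> hx; apply: (prec_ins_headE (z := x)); rewrite // /bump; lia.
split=> //; try (rewrite size_ins; lia).
- by move=> b; rewrite size_ins => hb; rewrite si ?size_ins //; lia.
- by exists 1; rewrite size_ins; [apply: top|]; lia.
- by move=> _; rewrite size_ins; apply: top; lia.
Qed.

Lemma typeX_low p : typeX p -> typeX (ins 1 p).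
Proof.
case=> gp hS [y yn] [z nz].
have yb := prec_bound gp yn; have zb := prec_bound gp nz.
have ny := prec_neq gp yn; have nz' := prec_neq gp nz.
have [gi si] : good (ins 1 p) /\
    sites (ins 1 p) (fun b => (b == 1) || (size p < b)).
  apply: (step_ins gp hS) => // [b|b y1 z1|b hb nb ub].
  - rewrite /unbump; lia.
  - rewrite /pkill; lia.
  exists (size p), z; split=> //; move: ub; rewrite /pkill /unbump; lia.
split=> //.
- by move=> b; rewrite size_ins => hb; rewrite si ?size_ins //; lia.
- exists 1; rewrite size_ins; apply: (prec_ins_headE (z := size p)) => //.
    lia.
  by rewrite /bump; lia.
- by exists (bump 1 z); apply: (prec_insE nz); rewrite // size_ins /bump; lia.
Qed.

Lemma typeX_mid p : typeX p -> typeB 2 (ins (size p) p).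
Proof.
case=> gp hS [y yn] [z nz].
have yb := prec_bound gp yn; have zb := prec_bound gp nz.
have ny := prec_neq gp yn; have nz' := prec_neq gp nz.
have [gi si] : good (ins (size p) p) /\
    sites (ins (size p) p) (fun b => size p < b).
  apply: (step_ins gp hS) => // [||b|b y1 z1|b hb nb ub].
  - lia.
  - lia.
  - rewrite /unbump; lia.
  - rewrite /pkill; lia.
  (* Site 1 completes 1324 using a letter before the old maximum; site [size p] completes 2341 using
     a letter after it. *)
  have [b1|b1] := eqVneq b 1.
    by exists y, (size p); split=> //; move: ub; rewrite /pkill /unbump; lia.
  by exists (size p), z; split=> //; move: ub; rewrite /pkill /unbump; lia.
split=> //; try (rewrite size_ins; lia).
- by move=> b; rewrite size_ins => hb; rewrite si ?size_ins //; lia.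
by exists z; rewrite size_ins; [apply: (prec_insE nz)|]; rewrite /bump; lia.
Qed.

Lemma typeX_top p : typeX p -> typeG (size p) 1 1 (ins (size p).+1 p).
Proof.
case=> gp hS [y yn] [z nz].
have yb := prec_bound gp yn; have zb := prec_bound gp nz.
have ny := prec_neq gp yn; have nz' := prec_neq gp nz.
have [|||gi si] :=
  top_ins (S' := fun b => (b == 1) || (size p <= b)) gp hS; try lia.
split=> //; first by split; rewrite ?size_ins; lia.
- by move=> b; rewrite size_ins => hb; rewrite si ?size_ins //; lia.
- move=> y1 z1; rewrite size_ins => hy hz.
  have -> : y1 = (size p).+1 by lia.
  by apply: (prec_ins_headE (z := z1)) => //; rewrite ?/bump; lia.
move=> c c1 c2; exists y, (size p); split; last by lia.
by apply: (prec_insE yn); rewrite /bump; lia.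
Qed.

Lemma typeG_low m j i p : typeG m j i p -> typeX (ins 1 p).
Proof.
case=> gp [sp jm i0] hS hd asc.
have [gi si] : good (ins 1 p) /\
    sites (ins 1 p) (fun b => (b == 1) || (size p < b)).
  apply: (step_ins gp hS) => // [b|b y1 z1|b hb nb ub].
  - rewrite /unbump; lia.
  - rewrite /pkill; lia.
  exists (size p), (size p).-1; split; first by apply: hd; lia.
  move: ub; rewrite /pkill /unbump; lia.
split=> //.
- by move=> b; rewrite size_ins => hb; rewrite si ?size_ins //; lia.
- exists 1; rewrite size_ins; apply: (prec_ins_headE (z := size p)) => //.
    lia.
  by rewrite /bump; lia.
- have nz : prec p (size p) 1 by apply: hd; lia.
  by exists 2; apply: (prec_insE nz); rewrite // size_ins /bump; lia.
Qed.

Lemma typeG_mid m j i p a : typeG m j i p -> m < a + j -> a <= m ->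
  typeB 2 (ins a p).
Proof.
case=> gp [sp jm i0] hS hd asc aj am.
have [gi si] : good (ins a p) /\ sites (ins a p) (fun b => size p < b).
  apply: (step_ins gp hS) => // [||b|b y1 z1|b hb nb ub].
  - lia.
  - lia.
  - rewrite /unbump; lia.
  - rewrite /pkill; lia.
  (* Above [a], 2143 arises with the two largest letters. Otherwise the pair [y < a <= z] gives 1324
     if [b <= y], and the maximum followed by [y] gives 2341 if [y < b]. *)
  case: (leqP b a) => ba; last first.
    exists (size p), (size p).-1; split; first by apply: hd; lia.
    rewrite /pkill; lia.
  have [y [z [yz le_yz]]] := asc a aj am; have := prec_bound gp yz => yb.
  case: (leqP b y) => by_.
    by exists y, z; split=> //; rewrite /pkill; lia.
  exists (size p), y; split; first by apply: hd; lia.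
  rewrite /pkill; lia.
split=> //; try (rewrite size_ins; lia).
- by move=> b; rewrite size_ins => hb; rewrite si ?size_ins //; lia.
have nz : prec p (size p) 1 by apply: hd; lia.
by exists 1; rewrite size_ins; [apply: (prec_insE nz)|]; rewrite /bump; lia.
Qed.

Lemma typeG_high m j i p a : typeG m j i p -> m < a <= size p ->
  typeX (ins a p).
Proof.
case=> gp [sp jm i0] hS hd asc le_a.
have [gi si] : good (ins a p) /\
    sites (ins a p) (fun b => (b == 1) || (size p < b)).
  apply: (step_ins gp hS) => // [||b|b y z hb Sb yz yzb|b hb nb ub].
  - lia.
  - lia.
  - rewrite /unbump; lia.
  - apply/negP=> K; case: (prec_asym gp yz); apply: hd.
      move: K; rewrite /pkill; lia.
    move: K; rewrite /pkill; lia.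
  (* Sites above [a] complete 2143 with the two largest letters, sites from 2 to [a] complete 2341
     with the maximum and 1. *)
  case: (leqP b a) => ba; last first.
    exists (size p), (size p).-1; split; first by apply: hd; lia.
    rewrite /pkill; lia.
  exists (size p), 1; split; first by apply: hd; lia.
  rewrite /pkill; lia.
split=> //.
- by move=> b; rewrite size_ins => hb; rewrite si ?size_ins //; lia.
- exists a; rewrite size_ins; apply: (prec_ins_headE (z := size p)) => //.
    lia.
  by rewrite /bump; lia.
- have nz : prec p (size p) 1 by apply: hd; lia.
  by exists 1; apply: (prec_insE nz); rewrite // ?size_ins /bump; lia.
Qed.

Lemma typeG_top m j i p : typeG m j i p -> typeG m j i.+1 (ins (size p).+1 p).
Proof.
case=> gp [sp jm i0] hS hd asc.
have [|||gi si] :=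
  top_ins (S' := fun b => (b == 1) || (m < b + j)) gp hS; try lia.
split=> //; first by split; rewrite ?size_ins; lia.
- move=> y z; rewrite size_ins => hy hz; case: (leqP y (size p)) => yp.
    have yz : prec p y z by apply: hd; lia.
    by apply: (prec_insE yz); rewrite /bump; lia.
  have -> : y = (size p).+1 by lia.
  by apply: (prec_ins_headE (z := z)) => //; rewrite ?/bump; lia.
move=> c c1 c2; have [y [z [yz le_yz]]] := asc c c1 c2.
have yb := prec_bound gp yz.
exists y, z; split=> //.
by apply: (prec_insE yz); rewrite /bump; lia.
Qed.

(** * The increasing permutation and its children *)

Lemma prec_iota k y z : 0 < y < z -> z <= k -> prec (iota 1 k) y z.
Proof.
move=> hy hz; rewrite /prec.
have -> : iota 1 k = iota 1 y ++ iota y.+1 (k - y).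
  by rewrite -(iotaD 1 y) ; congr iota; lia.
by apply: (@cat_subseq _ [:: y] [:: z]); rewrite sub1seq mem_iota; lia.
Qed.

Lemma good_iota k : good (iota 1 k).
Proof.
split; first by rewrite size_iota.
move=> a x y z sub; have := subseq_sorted ltn_trans sub (iota_ltn_sorted 1 k).
rewrite /bad /=; lia.
Qed.

(** Each disjunct of [kill] forces a descent among the three letters, and the increasing word has
    none. *)
Lemma sites_iota k : sites (iota 1 k) (fun b => 0 < b).
Proof.
move=> b hb; split=> [_|_ x y z sub]; first by lia.
have := subseq_sorted ltn_trans sub (iota_ltn_sorted 1 k).
rewrite /kill /=; lia.
Qed.

Lemma ins_iota k : ins 1 (iota 1 k) = iota 1 k.+1.
Proof.
rewrite /ins /=; congr cons; rewrite -[2]/(1 + 1) iotaDl.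
by apply/eq_in_map => x; rewrite mem_iota /bump; lia.
Qed.

Lemma iota_mid k a : 1 < a <= k -> typeC a (k - a) (ins a (iota 1 k)).
Proof.
move=> le_a; rewrite -[X in X - a](size_iota 1).
apply: (@typeC_mid 1) => //; rewrite ?size_iota //.
- exact: good_iota.
- exact: sites_iota.
by move=> y z hy hz; apply: prec_iota; lia.
Qed.

Lemma iota_top k : 0 < k -> typeG k k.-1 1 (ins k.+1 (iota 1 k)).
Proof.
move=> k0; have := top_ins (S' := fun b => 0 < b) (good_iota k) (@sites_iota k).
rewrite size_iota => -[] // gi si.
split=> //; first by split; rewrite ?size_ins ?size_iota; lia.
- move=> b; rewrite size_ins size_iota => hb.
  by rewrite si ?size_ins ?size_iota //; lia.
- move=> y z; rewrite size_ins size_iota => hy hz.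
  have -> : y = k.+1 by lia.
  apply: (prec_ins_headE (z := z)); [exact: good_iota| rewrite size_iota; lia|].
  rewrite /bump; lia.
move=> c c1 c2; exists c.-1, c; split; last by lia.
by apply: (@prec_insE _ _ c.-1 c); [apply: prec_iota| |]; rewrite ?/bump; lia.
Qed.

(** * Numbers of descendants *)

Definition active (p : seq nat) : seq nat :=
  [seq b <- iota 1 (size p).+1 | avT (ins b p)].

Fixpoint desc (r : nat) (p : seq nat) : nat :=
  if r is r'.+1 then \sum_(b <- active p) desc r' (ins b p) else 1.

Lemma descS r p : desc r.+1 p = \sum_(b <- active p) desc r (ins b p).
Proof. by []. Qed.

Lemma sum_active (S : pred nat) p (F : nat -> nat) :
  good p -> sites p S ->
  \sum_(b <- active p) F b = \sum_(1 <= b < (size p).+2 | S b) F b.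
Proof.
case=> _ av hS; rewrite big_filter /index_iota subSS subn0 big_seq_cond.
rewrite [RHS]big_seq_cond; apply: eq_bigl => b; rewrite mem_iota.
case: (boolP (1 <= b < _)) => //= hb.
by apply/avoidP/idP; rewrite avoid_ins hS //; tauto.
Qed.

Lemma sum_ge m n (F : nat -> nat) : 1 <= m <= n.+1 ->
  \sum_(1 <= b < n.+2 | m <= b) F b = \sum_(m <= b < n.+1) F b + F n.+1.
Proof.
move=> hm; rewrite (big_cat_nat (n := m)) /=; try lia.
rewrite big_nat_cond big1 ?add0n; last by move=> b; lia.
rewrite -big_nat_recr /=; last by lia.
by rewrite big_nat_cond [RHS]big_nat_cond; apply: eq_bigl => b; lia.
Qed.

Lemma sum_1ge m n (F : nat -> nat) : 1 < m <= n.+1 ->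
  \sum_(1 <= b < n.+2 | (b == 1) || (m <= b)) F b =
  F 1 + \sum_(m <= b < n.+1) F b + F n.+1.
Proof.
move=> hm; rewrite big_ltn_cond //= -addnA; congr addn.
rewrite -sum_ge; last by lia.
rewrite [RHS]big_ltn_cond // ifF; last by lia.
by rewrite big_nat_cond [RHS]big_nat_cond; apply: eq_bigl => b; lia.
Qed.

Lemma sum_nat_eq m n (F : nat -> nat) c :
  (forall b, m <= b < n -> F b = c) -> \sum_(m <= b < n) F b = (n - m) * c.
Proof.
by move=> h; rewrite (eq_big_nat _ _ h) sum_nat_const_nat.
Qed.

Fixpoint cntB (r k : nat) : nat :=
  if r is r'.+1 then k.-1 * cntB r' 2 + cntB r' k.+1 else 1.

Fixpoint cntG (r j i : nat) : nat :=
  if r is r'.+1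
  then i.+1 * cntG r' 1 0 + j * cntB r' 2 + cntG r' j i.+1 else 1.

Fixpoint cntC (r l : nat) : nat :=
  if r is r'.+1
  then cntC r' l + \sum_(0 <= j < l.+1) cntC r' j + cntB r' l.+4 else 1.

Fixpoint cntI (r h : nat) : nat :=
  if r is r'.+1
  then cntI r' h.+1 + \sum_(0 <= j < h) cntC r' j + cntG r' h 1 else 1.

Lemma desc_typeB r k p : typeB k p -> desc r p = cntB r k.
Proof.
elim: r k p => //= r IHr k p tp; have [gp lek hS _ _] := tp.
rewrite (sum_active _ gp hS).
rewrite (eq_bigl (fun b => (size p).+2 - k <= b)); last first.
  by move=> b; rewrite leq_subLR addnC.
rewrite sum_ge; last by lia.
rewrite (IHr _ _ (typeB_top tp)) (sum_nat_eq (c := cntB r 2)).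
  by congr (_ * _ + _); lia.
move=> b hb; apply/IHr/(typeB_low tp); lia.
Qed.

Lemma sum_rev_sub m n (F : nat -> nat) :
  \sum_(m.+1 <= b < n.+1) F (n - b) = \sum_(0 <= j < n - m) F j.
Proof.
rewrite big_nat_rev /= -{1}[m.+1]add0n big_addn subSS.
by apply: eq_big_nat => j hj; congr F; lia.
Qed.

Lemma desc_typeC r m l p : typeC m l p -> desc r p = cntC r l.
Proof.
elim: r m l p => //= r IHr m l p tp; have [gp sp hS tl [z mz ltz]] := tp.
rewrite (sum_active _ gp hS) sum_ge; last by lia.
rewrite (desc_typeB _ (typeC_top tp)) big_ltn; last by lia.
rewrite (IHr _ _ _ (typeC_bottom tp)); congr (_ + _ + _).
rewrite (_ : l.+1 = size p - m); last by lia.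
rewrite -sum_rev_sub; apply: eq_big_nat => b hb.
by apply/(IHr b)/(typeC_mid gp _ hS tl); lia.
Qed.

(** One induction treats both labels, since each occurs among the children of the other. *)
Lemma desc_typeXG r :
  (forall p, typeX p -> desc r p = cntG r 1 0) /\
  (forall m j i p, typeG m j i p -> desc r p = cntG r j i).
Proof.
elim: r => [//|r [IHX IHG]]; split=> [p tp | m j i p tp] /=.
  have [gp hS [y yn] [z nz]] := tp.
  have n1 : 1 < size p.
    have := prec_bound gp yn; have := prec_neq gp yn; lia.
  rewrite (sum_active _ gp hS) sum_1ge ?n1 //= big_nat1.
  rewrite (IHX _ (typeX_low tp)) (desc_typeB _ (typeX_mid tp)).
  by rewrite (IHG _ _ _ _ (typeX_top tp)) !mul1n.
have [gp [sp jm i0] hS _ _] := tp.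
rewrite (sum_active _ gp hS).
rewrite (eq_bigl (fun b => (b == 1) || (m.+1 - j <= b))); last first.
  by move=> b; rewrite leq_subLR addnC.
rewrite sum_1ge; last by lia.
rewrite (IHX _ (typeG_low tp)) (IHG _ _ _ _ (typeG_top tp)).
(* The [j] sites up to [m] lead to [typeB 2], the [i] sites from [m.+1] to [size p] lead to [typeX];
   site 1 adds one more [typeX], hence the factor [i.+1]. *)
rewrite (big_cat_nat (n := m.+1)) /=; try lia.
rewrite (sum_nat_eq (c := cntB r 2)); last first.
  by move=> b hb; apply/desc_typeB/(typeG_mid tp); lia.
rewrite (sum_nat_eq (c := cntG r 1 0)); last first.
  by move=> b hb; apply/IHX/(typeG_high tp); lia.
rewrite (_ : m.+1 - (m.+1 - j) = j); last by lia.
rewrite (_ : (size p).+1 - m.+1 = i); last by lia.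
by rewrite mulSn; lia.
Qed.

Lemma desc_iota r h : desc r (iota 1 h.+1) = cntI r h.
Proof.
elim: r h => [//|r IHr] h; rewrite descS.
rewrite (sum_active _ (good_iota h.+1) (@sites_iota h.+1)) sum_ge; last by lia.
have [_ descG] := desc_typeXG r.
rewrite size_iota big_ltn // ins_iota IHr (descG _ _ _ _ (iota_top _)) //.
congr (_ + _ + _); rewrite -[h in RHS](subn1 h.+1).
rewrite -(sum_rev_sub 1 h.+1); apply: eq_big_nat => b hb.
by apply/desc_typeC/iota_mid; lia.
Qed.

(** * The generating tree enumerates the avoiders *)

Fixpoint level (n : nat) : seq (seq nat) :=
  if n is n'.+1 then [seq ins a p | p <- level n', a <- active p]
  else [:: [::]].

Lemma sum_level n r : \sum_(p <- level n) desc r p = desc (n + r) [::].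
Proof.
elim: n r => [|n IHn] r; first by rewrite big_seq1.
by rewrite big_allpairs_dep -[RHS]/(desc (n + r).+1 [::]) -addnS -IHn.
Qed.

Lemma size_level n : size (level n) = desc n [::].
Proof. by rewrite -[n in RHS]addn0 -sum_level sum1_size. Qed.

Lemma ins_inj a b p q : ins a p = ins b q -> a = b /\ p = q.
Proof. by case=> -> /(inj_map (can_inj (bumpK b))) ->. Qed.

Lemma uniq_level n : uniq (level n).
Proof.
elim: n => //= n IHn; apply: allpairs_uniq_dep => //.
  by move=> p _; apply/filter_uniq/iota_uniq.
by move=> [p a] [q b] _ _ /= /ins_inj[-> ->].
Qed.

Lemma mem_active p a : good p ->
  (a \in active p) = (1 <= a <= (size p).+1) && avT (ins a p).
Proof. by move=> gp; rewrite mem_filter mem_iota add1n ltnS andbC. Qed.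

(** Lowering the letters above the first one inverts [ins], and avoidance passes to the shorter
    word; hence every avoider has a parent in the tree. *)
Lemma good_behead x p : good (x :: p) ->
  exists2 q, good q & x :: p = ins x q /\ size q = size p.
Proof.
case=> hp av; pose q := map (unbump x) p.
have /andP[xp up] : uniq (x :: p) by rewrite (perm_uniq hp) iota_uniq.
have px y : y \in p -> [&& 1 <= y, y <= (size p).+1 & y != x].
  move=> yp; have := perm_mem hp y; rewrite inE yp orbT mem_iota /= => /esym hy.
  apply/and3P; split; try lia.
  by apply/eqP=> yx; rewrite -yx yp in xp.
have hx : 1 <= x <= (size p).+1.
  by have := perm_mem hp x; rewrite inE eqxx mem_iota /= => /esym; lia.
have qE : x :: p = ins x q.
  congr cons; rewrite -map_comp -[LHS]map_id; apply/eq_in_map=> y /px hy /=.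
  by rewrite unbumpK // inE; lia.
exists q; last by rewrite size_map.
split; last by have [] := (avoid_ins x q).1; rewrite -?qE.
apply: uniq_perm; last 1 first.
- move=> y; rewrite mem_iota size_map; apply/mapP/idP=> [[z /px hz ->]|hy].
    rewrite /unbump; lia.
  exists (bump x y); last by rewrite bumpK.
  have := perm_mem hp (bump x y); rewrite inE mem_iota /=.
  by rewrite /bump; lia.
- rewrite map_inj_in_uniq.
    by [].
  move=> y z /px hy /px hz; rewrite /unbump; lia.
exact: iota_uniq.
Qed.

Lemma mem_level n p : p \in level n <-> size p = n /\ good p.
Proof.
elim: n p => [|n IHn] p.
  rewrite inE; split=> [/eqP->|[/size0nil->]] //.
split=> [/allpairsPdep[q [a [/IHn[<- gq] + ->]]]|[]].
  rewrite mem_active // => /andP[ha /avoidP hav]; split; first exact: size_ins.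
  by split=> //; rewrite size_ins; apply: perm_ins => //; case: gq.
case: p => // x p [sp] gxp; have [q gq [qE sq]] := good_behead gxp.
apply/allpairsPdep; exists q, x; split=> //; first by apply/IHn; rewrite sq.
have [hp av] := gxp; rewrite mem_active // -qE.
apply/andP; split; last exact/avoidP.
by have := perm_mem hp x; rewrite inE eqxx mem_iota /= => /esym; lia.
Qed.

(** * From words to permutations *)

Lemma oneline_inj n : injective (@oneline n).
Proof.
move=> s t /eq_in_map st; apply/permP=> i; apply/val_inj/succn_inj/st.
by rewrite mem_enum.
Qed.

Lemma oneline_perm n (s : 'S_n) : perm_eq (oneline s) (iota 1 n).
Proof.
have sizeE : size (oneline s) = size (iota 1 n).
  by rewrite size_map size_enum_ord size_iota.
have uo : uniq (oneline s).
  rewrite map_inj_uniq ?enum_uniq // => i j /succn_inj /val_inj.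
  exact: perm_inj.
apply: uniq_perm => //; first exact: iota_uniq.
apply: (uniq_min_size uo _ _).2 => [x /mapP[i _ ->]|]; last by rewrite sizeE.
by rewrite mem_iota add1n; apply: (ltn_ord (s i)).
Qed.

(** Injectivity of [oneline] and the count [n!] on both sides turn one inclusion into equality, so
    no permutation has to be built from a word. *)
Lemma mem_oneline n p :
  (p \in map (@oneline n) (enum [set: 'S_n])) = perm_eq p (iota 1 n).
Proof.
rewrite -mem_permutations; move: p.
apply: (uniq_min_size _ _ _).2.
- by rewrite (map_inj_uniq (@oneline_inj n)) enum_uniq.
- by move=> p /mapP[s _ ->]; rewrite mem_permutations oneline_perm.
rewrite size_map -cardE cardsT card_Sn.
by rewrite size_permutations ?iota_uniq ?size_iota.
Qed.

Lemma card_avoiders_desc n :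
  #|avoiders n [:: [:: 1; 3; 2; 4]; [:: 2; 1; 4; 3]; [:: 2; 3; 4; 1]]| =
  desc n [::].
Proof.
rewrite -size_level cardE -(size_map (@oneline n)); apply/perm_size/uniq_perm.
- by rewrite (map_inj_uniq (@oneline_inj n)) enum_uniq.
- exact: uniq_level.
move=> p; apply/mapP/idP=> [[s]|/mem_level[sp [hp av]]].
  rewrite mem_enum inE => /avoidP av ->; apply/mem_level.
  have hp := oneline_perm s; have sz := perm_size hp.
  by rewrite size_iota in sz; do 2!split=> //; rewrite sz.
rewrite sp -mem_oneline in hp; have [s _ pE] := mapP hp; exists s => //.
by rewrite mem_enum inE -pE; apply/avoidP.
Qed.

Lemma card_avoiders n :
  #|avoiders n.+1 [:: [:: 1; 3; 2; 4]; [:: 2; 1; 4; 3]; [:: 2; 3; 4; 1]]| =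
  cntI n 0.
Proof.
rewrite card_avoiders_desc descS (sum_active _ (good_iota 0) (@sites_iota 0)).
by rewrite big_mkcond big_nat1 /= (desc_iota n 0).
Qed.

(** * Linear recurrences *)

(** Value at [k = 2] and slope in [k] of [cntB r]. These are the Fibonacci numbers [F_(2r+1)] and
    [F_(2r)]; the step matrix has characteristic polynomial [t^2 - 3t + 1], the source of
    [1 - 3x + x^2]. *)
Fixpoint affB (r : nat) : nat * nat :=
  if r is r'.+1 then let: (b, v) := affB r' in (2 * b + v, b + v) else (1, 0).

Lemma cntB_affine r k : cntB r k.+2 = (affB r).1 + k * (affB r).2.
Proof.
elim: r k => [|r IHr] k /=; first by rewrite muln0.
rewrite !IHr mul0n addn0; case: (affB r) => b v /=; ring.
Qed.

(** Constant term and slope in [i] of [cntG r]; the slope in [j] is that of [cntB]. The step matrix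
    is the one of [affB], driven by [(affB r').2], and this resonance squares the factor
    [1 - 3x + x^2]. *)
Fixpoint affG (r : nat) : nat * nat :=
  if r is r'.+1 then
    let: (g0, g1) := affG r' in
    (2 * g0 + g1 + (affB r').2, g0 + g1 + (affB r').2)
  else (1, 0).

Lemma cntG_affine r j i :
  cntG r j i = (affG r).1 + i * (affG r).2 + j * (affB r).2.
Proof.
elim: r j i => [|r IHr] j i /=; first by rewrite !muln0.
rewrite !IHr (cntB_affine r 0); case: (affB r) (affG r) => b v [g0 g1] /=; ring.
Qed.

(** * Sums along antidiagonals *)

Definition adiag (F : nat -> nat -> nat) (n : nat) : nat :=
  \sum_(0 <= h < n.+1) F (n - h) h.

Lemma adiag_recl F n :
  adiag F n.+1 = F n.+1 0 + adiag (fun r h => F r h.+1) n.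
Proof. by rewrite /adiag big_nat_recl. Qed.

Lemma adiag_recr F n :
  adiag F n.+1 = adiag (fun r h => F r.+1 h) n + F 0 n.+1.
Proof.
rewrite /adiag big_nat_recr //= subnn; congr addn.
by apply: eq_big_nat => h hh; rewrite subSn.
Qed.

Lemma adiagD F G n :
  adiag (fun r h => F r h + G r h) n = adiag F n + adiag G n.
Proof. by rewrite /adiag big_split. Qed.

Lemma eq_adiag F G n : (forall r h, F r h = G r h) -> adiag F n = adiag G n.
Proof. by move=> FG; apply: eq_bigr => h _. Qed.

Definition sumC (r h : nat) : nat := \sum_(0 <= j < h) cntC r j.

Definition diagSumC := adiag sumC.
Definition diagC := adiag cntC.
Definition diagB := adiag (fun r h => cntB r h.+4).
Definition diagG := adiag (fun r h => cntG r h 1).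
Definition diagV := adiag (fun r h => (affB r).2).

Lemma diagSumC_rec n : diagSumC n.+1 = diagSumC n + diagC n.
Proof.
rewrite /diagSumC adiag_recl /sumC big_nil add0n -adiagD.
by apply: eq_adiag => r h; rewrite big_nat_recr.
Qed.

Lemma diagC_rec n : diagC n.+1 = 2 * diagC n + diagSumC n + diagB n + 1.
Proof.
rewrite /diagC adiag_recr /= !adiagD -/(diagC n) -/(diagB n).
have -> : adiag (fun r h => \sum_(0 <= j < h.+1) cntC r j) n =
    diagSumC n + diagC n.
  by rewrite -adiagD; apply: eq_adiag => r h; rewrite big_nat_recr.
lia.
Qed.

(** In Fibonacci terms, the even-indexed numbers up to [F_(2n)] sum to [F_(2n+1) - 1]. *)
Lemma diagV_sum n : diagV n + 1 = (affB n).1.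
Proof.
elim: n => [|n IHn]; first by rewrite /diagV /adiag big_nat1.
rewrite /diagV adiag_recl -/(diagV n) /=; case: (affB n) IHn => b v /=; lia.
Qed.

(** Raising [h] by one adds the slope [(affB r).2] to each term, so [diagB] grows by [cntB n.+1 4]
    and [diagV n]. Negative terms of the closed form stand on the left to stay in [nat]. *)
Lemma diagB_sum n : diagB n + n + 2 = 3 * (affB n).1 + 2 * (affB n).2.
Proof.
elim: n => [|n IHn]; first by rewrite /diagB /adiag big_nat1.
have diagBS : diagB n.+1 = cntB n.+1 4 + diagB n + diagV n.
  rewrite /diagB adiag_recl -addnA -adiagD; congr addn.
  by apply: eq_adiag => r h; rewrite !(cntB_affine r) mulSn; lia.
rewrite diagBS (cntB_affine n.+1); have := diagV_sum n => /=.
case: (affB n) IHn => b v /=; lia.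
Qed.

Lemma diagG_sum n :
  diagG n + n + (affB n).1 = 2 * (affB n).2 + 2 * (affG n).1 + (affG n).2.
Proof.
elim: n => [|n IHn]; first by rewrite /diagG /adiag big_nat1.
have diagGS : diagG n.+1 = cntG n.+1 0 1 + diagG n + diagV n.
  rewrite /diagG adiag_recl -addnA -adiagD; congr addn.
  by apply: eq_adiag => r h; rewrite !(cntG_affine r) mulSn; lia.
rewrite diagGS cntG_affine; have := diagV_sum n => /=.
case: (affB n) (affG n) IHn => b v [g0 g1] /=; lia.
Qed.

(** Along the chain [I h], [I (h+1)], ... the [C] and [G] subtrees that leave at step [d] have
    remaining depth [n - d]; the 1 counts the increasing permutation ending the chain. *)
Lemma cntI_adiag n h :
  cntI n.+1 h = 1 + adiag (fun r d => sumC r (h + d) + cntG r (h + d) 1) n.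
Proof.
elim: n h => [|n IHn] h; first by rewrite /adiag big_nat1 /= addn0 addnA.
rewrite [LHS]/(cntI n.+1 h.+1 + sumC n.+1 h + cntG n.+1 h 1).
rewrite IHn adiag_recl addn0.
rewrite (eq_adiag (G := fun r d => sumC r (h + d.+1) + cntG r (h + d.+1) 1)).
  lia.
by move=> r d; rewrite addnS.
Qed.

Lemma cntI_eq n : cntI n.+1 0 = 1 + diagSumC n + diagG n.
Proof. by rewrite cntI_adiag adiagD addnA. Qed.

Local Open Scope ring_scope.
Import GRing.Theory.

(** The coefficients are those of [(1 - x)(1 - 3x + x^2)^2]. Every term is linear in [diagSumC n],
    [diagC n], [n] and the pairs [affB n], [affG n], so linear arithmetic suffices. *)
Lemma cntI_rec n :
  (cntI n.+4.+2 0)%:Z - 7 * (cntI n.+4.+1 0)%:Z + 17 * (cntI n.+4 0)%:Z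
  - 17 * (cntI n.+3 0)%:Z + 7 * (cntI n.+2 0)%:Z - (cntI n.+1 0)%:Z = 0.
Proof.
rewrite !cntI_eq.
have := (diagSumC_rec n, diagSumC_rec n.+1, diagSumC_rec n.+2,
         diagSumC_rec n.+3, diagSumC_rec n.+4).
have := (diagC_rec n, diagC_rec n.+1, diagC_rec n.+2, diagC_rec n.+3).
have := (diagB_sum n, diagB_sum n.+1, diagB_sum n.+2, diagB_sum n.+3).
have := (diagG_sum n, diagG_sum n.+1, diagG_sum n.+2, diagG_sum n.+3,
         diagG_sum n.+4, diagG_sum n.+4.+1) => /=.
case: (affB n) (affG n) => b v [g0 g1] /= [[[[[]]]]] ? ? ? ? ? ?.
move=> [[[]]] ? ? ? ? [[[]]] ? ? ? ? [[[[]]]] ? ? ? ? ?.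
lia.
Qed.

(** * Formal power series *)

(** Coefficient [n] only sees terms up to [n], so associativity can be borrowed from polynomials. *)
Lemma fps_mul_trunc (R : nzRingType) (f g : fps R) n N : (n < N)%N ->
  fps_mul f g n = (\poly_(i < N) f i * \poly_(i < N) g i)`_n.
Proof.
move=> nN; rewrite coefM; apply: eq_bigr => i _.
by have := ltn_ord i; rewrite !coef_poly => lti; rewrite !ifT //; lia.
Qed.

Lemma fps_mulA (R : nzRingType) (f g h : fps R) :
  fps_mul f (fps_mul g h) =1 fps_mul (fps_mul f g) h.
Proof.
move=> n; pose P (u : fps R) := \poly_(i < n.+1) u i.
transitivity ((P f * P g * P h)`_n).
  rewrite -mulrA coefM; apply: eq_bigr => i _.
  by rewrite coef_poly ltn_ord (fps_mul_trunc _ _ (N := n.+1)) // ltnS leq_subr.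
rewrite coefM; apply: eq_bigr => i _.
by rewrite [(P h)`__]coef_poly ltnS leq_subr (fps_mul_trunc _ _ (N := n.+1)).
Qed.

Lemma fps_mul1 (R : nzRingType) (f : fps R) : fps_mul f (fps_of_poly 1) =1 f.
Proof.
move=> n; rewrite /fps_mul /fps_of_poly big_ord_recr /= subnn coef1 mulr1.
rewrite big1 ?add0r // => i _; rewrite coef1 gtn_eqF ?mulr0 //.
by rewrite subn_gt0.
Qed.

Lemma eq_fps_mul (R : nzRingType) (f f' g g' : fps R) :
  f =1 f' -> g =1 g' -> fps_mul f g =1 fps_mul f' g'.
Proof. by move=> ff gg n; apply: eq_bigr => i _; rewrite ff gg. Qed.

Lemma eq_fps_div (R : unitRingType) (f g h : fps R) :
  g 0%N \is a GRing.unit -> fps_mul h g =1 f -> h =1 fps_div f g.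
Proof.
move=> gU hg n; rewrite /fps_div -(eq_fps_mul hg (fun=> erefl)) -fps_mulA.
rewrite (@eq_fps_mul _ h h _ (fps_of_poly 1)) ?fps_mul1 //.
exact: fps_mulV.
Qed.

Lemma fps_mul_Poly (R : comNzRingType) (f : fps R) (s : seq R) n :
  (size s <= n.+1)%N ->
  fps_mul f (fps_of_poly (Poly s)) n = \sum_(i < size s) s`_i * f (n - i)%N.
Proof.
move=> sn; rewrite /fps_mul (reindex_inj rev_ord_inj) /=.
rewrite (big_ord_widen _ (fun i => s`_i * f (n - i)%N) sn) [RHS]big_mkcond /=.
apply: eq_bigr => i _; rewrite /fps_of_poly coef_Poly mulrC subSS.
have lein : (i <= n)%N by rewrite -ltnS.
rewrite subKn //; case: ltnP => // si.
by rewrite nth_default // mul0r.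
Qed.

Lemma numE : 1 - 6 * 'X + 12 * 'X^2 - 8 * 'X^3 + 3 * 'X^4 - 'X^5
  = Poly [:: 1; -6; 12; -8; 3; -1] :> {poly int}.
Proof. rewrite /= !cons_poly_def; ring. Qed.

Lemma denE : (1 - 'X) * (1 - 3 * 'X + 'X^2) ^+ 2
  = Poly [:: 1; -7; 17; -17; 7; -1] :> {poly int}.
Proof. rewrite /= !cons_poly_def; ring. Qed.

Definition n_avoiders (n : nat) : nat := if n is m.+1 then cntI m 0 else 1%N.

Lemma n_avoiders_small :
  [/\ n_avoiders 0 = 1, n_avoiders 1 = 1, n_avoiders 2 = 2 & n_avoiders 3 = 6]%N /\
  [/\ n_avoiders 4 = 21, n_avoiders 5 = 72 & n_avoiders 6 = 236]%N.
Proof.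
rewrite /n_avoiders !cntI_eq.
have T0 : diagSumC 0 = 0%N by rewrite /diagSumC /adiag big_nat1 /sumC big_nil.
have U0 : diagC 0 = 1%N by rewrite /diagC /adiag big_nat1.
have := (diagSumC_rec 0, diagSumC_rec 1, diagSumC_rec 2, diagSumC_rec 3).
have := (diagC_rec 0, diagC_rec 1, diagC_rec 2).
have := (diagB_sum 0, diagB_sum 1, diagB_sum 2, diagB_sum 3).
have := (diagG_sum 0, diagG_sum 1, diagG_sum 2, diagG_sum 3, diagG_sum 4) => /=.
move=> [[[[]]]] ? ? ? ? ? [[[]]] ? ? ? ? [[]] ? ? ? [[[]]] ? ? ? ?.
by split; split=> //; lia.
Qed.

Lemma n_avoiders_mul_den (f : nat -> nat) :
  [/\ f 0 = 1, f 1 = 1, f 2 = 2 & f 3 = 6]%N /\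
  [/\ f 4 = 21, f 5 = 72 & f 6 = 236]%N ->
  (forall n, (f n.+4.+3)%:Z - 7 * (f n.+4.+2)%:Z + 17 * (f n.+4.+1)%:Z
     - 17 * (f n.+4)%:Z + 7 * (f n.+3)%:Z - (f n.+2)%:Z = 0) ->
  fps_mul (fun n => (f n)%:Z) (fps_of_poly (Poly [:: 1; -7; 17; -17; 7; -1]))
  =1 fps_of_poly (Poly [:: 1; -6; 12; -8; 3; -1]).
Proof.
move=> [[f0 f1 f2 f3] [f4 f5 f6]] frec n; rewrite [RHS]coef_Poly.
(* The recurrence reaches down to [f n.+2] and no lower, so it covers the coefficients from 7 on;
   the first seven come from the given values. *)
case: (ltnP n 7) => n7.
  move: n n7; do 7?case=> //; move=> _;
    rewrite /fps_mul /fps_of_poly !big_ord_recr big_ord0 !coef_Poly /=;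
    rewrite ?(f0, f1, f2, f3, f4, f5, f6); lia.
rewrite fps_mul_Poly; last exact: (@leq_trans 7 _ _ _ (leqW n7)).
rewrite !big_ord_recr big_ord0 /=.
move: n n7; do 7?case=> //; move=> n _.
rewrite !subSS !subn0 [nth _ _ _]nth_default //; have := frec n; lia.
Qed.

Theorem theorem8 :
  gen_fun [:: [:: 1; 3; 2; 4]; [:: 2; 1; 4; 3]; [:: 2; 3; 4; 1]]%N
  =1 fps_div
       (fps_of_poly (1 - 6 * 'X + 12 * 'X^2 - 8 * 'X^3 + 3 * 'X^4 - 'X^5))
       (fps_of_poly ((1 - 'X) * (1 - 3 * 'X + 'X^2) ^+ 2)).
Proof.
rewrite numE denE; apply: eq_fps_div; first by rewrite /fps_of_poly coef_Poly.
move=> n; rewrite -(n_avoiders_mul_den n_avoiders_small (fun n => cntI_rec n)).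
apply: eq_fps_mul => // -[|m]; rewrite /gen_fun.
  by rewrite card_avoiders0.
by rewrite card_avoiders.
Qed.
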